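(* Let $(A,\cdot,[\cdot,\cdot,\cdot])$ be a ternary $F$-manifold algebra and let $(V;\rho,\mu)$ be a representation of $A$ satisfying, for all $x,y,z,t\in A$ and $u\in V$: $$\mathcal L_1(x\cdot y,z,t,u)=\mathcal L_1(y,z,t,\mu(x)u)+\mathcal L_1(x,z,t,\mu(y)u),$$ $$\mathcal L_3(x\cdot y,z,t,u)=-\mathcal L_3(y,z,t,\mu(x)u)-\mathcal L_3(x,z,t,\mu(y)u),$$ $$\mu(\mathcal L(x,y,z,t))u=\mathcal L_3(y,z,t,\mu(x)u)-\mu(x)\mathcal L_3(y,z,t,u).$$ Then $(V^*;\rho^*,-\mu^* )$ is a representation of $A$ (called the dual representation).
   Context: All vector spaces are over an algebraically closed field $\mathbb K$ of characteristic $0$. A 3-Lie algebra is a vector space $A$ with a skew-symmetric trilinear bracket satisfying $[x_1,x_2,[x_3,x_4,x_5]]=[[x_1,x_2,x_3],x_4,x_5]+[x_3,[x_1,x_2,x_4],x_5]+[x_3,x_4,[x_1,x_2,x_5]]$. A ternary $F$-manifold algebra is $(A,\cdot,[\cdot,\cdot,\cdot])$ with $(A,\cdot)$ commutative associative and $(A,[\cdot,\cdot,\cdot])$ a 3-Lie algebra such that, with $\mathcal L(x_1,x_2,x_3,x_4)=[x_1,x_2,x_3\cdot x_4]-x_3\cdot[x_1,x_2,x_4]-[x_1,x_2,x_3]\cdot x_4$, one has $\mathcal L(x_1\cdot x_2,x_3,x_4,x_5)=x_1\cdot\mathcal L(x_2,x_3,x_4,x_5)+x_2\cdot\mathcal L(x_1,x_3,x_4,x_5)$.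 A representation of a commutative associative algebra $(A,\cdot)$ on $V$ is a linear map $\mu:A\to\mathfrak{gl}(V)$ with $\mu(x\cdot y)=\mu(x)\mu(y)$. A representation of a 3-Lie algebra $A$ on $V$ is a skew-symmetric bilinear map $\rho:A\otimes A\to\mathfrak{gl}(V)$ with (i) $\rho(x_1,x_2)\rho(x_3,x_4)-\rho(x_3,x_4)\rho(x_1,x_2)=\rho([x_1,x_2,x_3],x_4)-\rho([x_1,x_2,x_4],x_3)$; (ii) $\rho([x_1,x_2,x_3],x_4)=\rho(x_1,x_2)\rho(x_3,x_4)+\rho(x_2,x_3)\rho(x_1,x_4)+\rho(x_3,x_1)\rho(x_2,x_4)$. Given such $\rho,\mu$ on $V$, for $x,y,z\in A$, $u\in V$ put $\mathcal L_1(x,y,z,u)=\rho(x,y)\mu(z)u-\mu(z)\rho(x,y)u-\mu([x,y,z])u$, $\mathcal L_2(x,y,z,u)=\mu(z)\rho(x,y)u+\mu(y)\rho(x,z)u-\rho(x,y\cdot z)u$, $\mathcal L_3(x,y,z,u)=\rho(x,y)\mu(z)u+\rho(x,z)\mu(y)u-\rho(x,y\cdot z)u$. $(V;\rho,\mu)$ is a representation of the ternary $F$-manifold algebra $A$ if $\rho$ is a representation of the 3-Lie algebra, $\mu$ is a representation of the commutative associative algebra, and for all $x_i\in A$, $u\in V$: $\mathcal L_1(x_1\cdot x_2,x_3,x_4,u)=\mu(x_1)\mathcal L_1(x_2,x_3,x_4,u)+\mu(x_2)\mathcal L_1(x_1,x_3,x_4,u)$; $\mathcal L_2(x_1\cdot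 x_2,x_3,x_4,u)=\mu(x_1)\mathcal L_2(x_2,x_3,x_4,u)+\mu(x_2)\mathcal L_2(x_1,x_3,x_4,u)$; $\mu(\mathcal L(x_1,x_2,x_3,x_4))u=\mathcal L_2(x_2,x_3,x_4,\mu(x_1)u)-\mu(x_1)\mathcal L_2(x_2,x_3,x_4,u)$. The maps $\rho^*:A\otimes A\to\mathfrak{gl}(V^* )$ and $\mu^*:A\to\mathfrak{gl}(V^* )$ are defined by $\langle\rho^*(x,y)\xi,v\rangle=-\langle\xi,\rho(x,y)v\rangle$ and $\langle\mu^*(x)\xi,v\rangle=-\langle\xi,\mu(x)v\rangle$. *)

(* Defs.v *)
From HB Require Import structures.
From mathcomp Require Import all_boot all_algebra.
From mathcomp Require Import boolp prodnormedzmodule.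

Set Implicit Arguments.
Unset Strict Implicit.
Unset Printing Implicit Defensive.

Import GRing.Theory.
Local Open Scope ring_scope.

(* Linear maps between two (possibly infinite-dimensional) modules form a     *)
(* module.  This lets n-linear maps be written in curried form, e.g. bilinear *)
(* maps as {linear U -> {linear V -> W}}, and makes the full algebraic dual   *)
(* {linear V -> K^o} a vector space.                                          *)
Section LinearMaps.
Variables (R : comNzRingType) (U V : lmodType R).
Implicit Types f g : {linear U -> V}.

Lemma eq_linear f g : f =1 g -> f = g.
Proof.
case: f g => [f [[a1] [b1]]] [g [[a2] [b2]]] /= /funext fg; subst g.
by rewrite (Prop_irrelevance a1 a2) (Prop_irrelevance b1 b2).
Qed.

Definition linear_zero : {linear U -> V} := \0.
Definition linear_opp f : {linear U -> V} := \- f.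
Definition linear_add f g : {linear U -> V} := f \+ g.
Definition linear_scale (a : R) f : {linear U -> V} := a \*: f.

Fact linear_addA : associative linear_add.
Proof. by move=> f g h; apply: eq_linear => u /=; rewrite addrA. Qed.
Fact linear_addC : commutative linear_add.
Proof. by move=> f g; apply: eq_linear => u /=; rewrite addrC. Qed.
Fact linear_add0 : left_id linear_zero linear_add.
Proof. by move=> f; apply: eq_linear => u /=; rewrite add0r. Qed.
Fact linear_addN : left_inverse linear_zero linear_opp linear_add.
Proof. by move=> f; apply: eq_linear => u /=; rewrite addNr. Qed.

HB.instance Definition _ := GRing.isZmodule.Build {linear U -> V}
  linear_addA linear_addC linear_add0 linear_addN.

Fact linear_scaleA a b f :
  linear_scale a (linear_scale b f) = linear_scale (a * b) f.
Proof. by apply: eq_linear => u /=; rewrite scalerA. Qed.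
Fact linear_scale1 : left_id 1 linear_scale.
Proof. by move=> f; apply: eq_linear => u /=; rewrite scale1r. Qed.
Fact linear_scaleDr : right_distributive linear_scale +%R.
Proof. by move=> a f g; apply: eq_linear => u /=; rewrite scalerDr. Qed.
Fact linear_scaleDl f : {morph linear_scale^~ f : a b / a + b}.
Proof. by move=> a b; apply: eq_linear => u /=; rewrite scalerDl. Qed.

HB.instance Definition _ := GRing.Zmodule_isLmodule.Build R {linear U -> V}
  linear_scaleA linear_scale1 linear_scaleDr linear_scaleDl.

Lemma linear_addE f g u : (f + g) u = f u + g u. Proof. by []. Qed.
Lemma linear_oppE f u : (- f) u = - f u. Proof. by []. Qed.
Lemma linear_scaleE a f u : (a *: f) u = a *: f u. Proof. by []. Qed.

End LinearMaps.

Section TernaryFManifold.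
Variables (K : fieldType) (A : lmodType K).

Definition is_comm_assoc (mul : {linear A -> {linear A -> A}}) : Prop :=
  (forall x y, mul x y = mul y x) /\
  (forall x y z, mul (mul x y) z = mul x (mul y z)).

Definition is_3Lie
    (br : {linear A -> {linear A -> {linear A -> A}}}) : Prop :=
  [/\ forall x y z, br x y z = - br y x z,
      forall x y z, br x y z = - br x z y
    & forall x1 x2 x3 x4 x5,
        br x1 x2 (br x3 x4 x5) =
          br (br x1 x2 x3) x4 x5 + br x3 (br x1 x2 x4) x5
          + br x3 x4 (br x1 x2 x5)].

Section Algebra.
Variables (mul : {linear A -> {linear A -> A}})
          (br : {linear A -> {linear A -> {linear A -> A}}}).

Definition calL (x1 x2 x3 x4 : A) : A :=
  br x1 x2 (mul x3 x4) - mul x3 (br x1 x2 x4) - mul (br x1 x2 x3) x4.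

Definition is_ternary_F_manifold : Prop :=
  [/\ is_comm_assoc mul,
      is_3Lie br
    & forall x1 x2 x3 x4 x5,
        calL (mul x1 x2) x3 x4 x5 =
          mul x1 (calL x2 x3 x4 x5) + mul x2 (calL x1 x3 x4 x5)].

Section Representation.
Variables (V : lmodType K)
          (rho : {linear A -> {linear A -> {linear V -> V}}})
          (mu : {linear A -> {linear V -> V}}).

Definition is_comm_assoc_rep : Prop :=
  forall x y u, mu (mul x y) u = mu x (mu y u).

Definition is_3Lie_rep : Prop :=
  [/\ forall x y u, rho x y u = - rho y x u,
      forall x1 x2 x3 x4 u,
        rho x1 x2 (rho x3 x4 u) - rho x3 x4 (rho x1 x2 u) =
          rho (br x1 x2 x3) x4 u - rho (br x1 x2 x4) x3 u
    & forall x1 x2 x3 x4 u,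
        rho (br x1 x2 x3) x4 u =
          rho x1 x2 (rho x3 x4 u) + rho x2 x3 (rho x1 x4 u)
          + rho x3 x1 (rho x2 x4 u)].

Definition calL1 (x y z : A) (u : V) : V :=
  rho x y (mu z u) - mu z (rho x y u) - mu (br x y z) u.

Definition calL2 (x y z : A) (u : V) : V :=
  mu z (rho x y u) + mu y (rho x z u) - rho x (mul y z) u.

Definition calL3 (x y z : A) (u : V) : V :=
  rho x y (mu z u) + rho x z (mu y u) - rho x (mul y z) u.

Definition is_ternary_F_manifold_rep : Prop :=
  [/\ is_3Lie_rep,
      is_comm_assoc_rep,
      forall x1 x2 x3 x4 u,
        calL1 (mul x1 x2) x3 x4 u =
          mu x1 (calL1 x2 x3 x4 u) + mu x2 (calL1 x1 x3 x4 u),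
      forall x1 x2 x3 x4 u,
        calL2 (mul x1 x2) x3 x4 u =
          mu x1 (calL2 x2 x3 x4 u) + mu x2 (calL2 x1 x3 x4 u)
    & forall x1 x2 x3 x4 u,
        mu (calL x1 x2 x3 x4) u =
          calL2 x2 x3 x4 (mu x1 u) - mu x1 (calL2 x2 x3 x4 u)].

End Representation.
End Algebra.
End TernaryFManifold.

Section Dual.
Variables (K : fieldType) (V : lmodType K).
Local Notation dualV := {linear V -> K^o}.

(* The action of gl(V) on V^*: <neg_tr f xi, v> = - <xi, f v>. *)
Section NegTranspose.
Variable f : {linear V -> V}.

Definition neg_tr_fun (xi : dualV) : dualV := - (xi \o f : dualV).

Fact neg_tr_fun_linear : linear neg_tr_fun.
Proof.
move=> a xi eta; apply: eq_linear => v.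
by rewrite /neg_tr_fun !(linear_addE, linear_oppE, linear_scaleE) /=
  opprD scalerN.
Qed.

HB.instance Definition _ :=
  GRing.isLinear.Build K dualV dualV *:%R neg_tr_fun neg_tr_fun_linear.

End NegTranspose.

Definition neg_tr (f : {linear V -> V}) : {linear dualV -> dualV} :=
  neg_tr_fun f.

Lemma neg_trE f (xi : dualV) v : neg_tr f xi v = - xi (f v).
Proof. by []. Qed.

Fact neg_tr_linear : linear neg_tr.
Proof.
move=> a f g; apply: eq_linear => xi; apply: eq_linear => v.
by rewrite !(linear_addE, linear_scaleE, neg_trE) linearP opprD scalerN.
Qed.

HB.instance Definition _ :=
  GRing.isLinear.Build K {linear V -> V} {linear dualV -> dualV} *:%R
    neg_tr neg_tr_linear.

Variable A : lmodType K.

Definition mu_dual (mu : {linear A -> {linear V -> V}}) :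
  {linear A -> {linear dualV -> dualV}} := neg_tr \o mu.

Section RhoDual.
Variable rho : {linear A -> {linear A -> {linear V -> V}}}.

Definition rho_dual_fun (x : A) : {linear A -> {linear dualV -> dualV}} :=
  neg_tr \o rho x.

Fact rho_dual_fun_linear : linear rho_dual_fun.
Proof.
move=> a x y; apply: eq_linear => z.
have -> : rho_dual_fun (a *: x + y) z = neg_tr (rho (a *: x + y) z) by [].
by rewrite linearP linear_addE linear_scaleE linearP.
Qed.

HB.instance Definition _ :=
  GRing.isLinear.Build K A {linear A -> {linear dualV -> dualV}} *:%R
    rho_dual_fun rho_dual_fun_linear.

Definition rho_dual : {linear A -> {linear A -> {linear dualV -> dualV}}} :=
  rho_dual_fun.

End RhoDual.

Lemma mu_dualE mu x (xi : dualV) v : mu_dual mu x xi v = - xi (mu x v).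
Proof. by []. Qed.

Lemma rho_dualE rho x y (xi : dualV) v :
  rho_dual rho x y xi v = - xi (rho x y v).
Proof. by []. Qed.

End Dual.

(* Main.v *)
(* With x1, ..., x4 fixed, write P = rho(x1,x2) rho(x3,x4) + rho(x2,x3) rho(x1,x4)
   + rho(x3,x1) rho(x2,x4) and Q for the sum of the same products in the opposite
   order.  The sum S of rho([x1,x2,x4],x3) over the cyclic permutations of x1, x2, x3
   is - P - 2 Q by (ii), while (i) gives P - Q = 3 rho([x1,x2,x3],x4) - S.  Hence
   rho([x1,x2,x3],x4) = - Q, which is what (ii) becomes on V^*.

   The dual operators satisfy L1^* = L1 transposed and L2^* = - (L3 transposed).
   The sign in the hypothesis on L3(x y, z, t, u) is thus opposite to the one that
   transposes to the condition on L2^*.  However L3(x, y, z) = L2(x, y, z)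
   + L1(x, y, z) + L1(x, z, y) is a derivation in x for the left action of mu;
   together with the two hypotheses on L3 and the skew-symmetry of the F-manifold
   tensor in its first two arguments this forces L3(x y, z, t, u) = 0, and then
   both signs hold. *)

Require Import Defs.
From mathcomp Require Import all_boot all_algebra ring.

Set Implicit Arguments.
Unset Strict Implicit.
Unset Printing Implicit Defensive.

Import GRing.Theory.
Local Open Scope ring_scope.

Lemma linear_subE (R : comNzRingType) (U V : lmodType R) (f g : {linear U -> V})
  u : (f - g) u = f u - g u.
Proof. by []. Qed.

Lemma eq_opp_eq0 (K : fieldType) (charK0 : [pchar K] =i pred0) (V : lmodType K)
  (v : V) : v = - v -> v = 0.
Proof.
move=> /eqP.
rewrite -addr_eq0 -mulr2n -scaler_nat scaler_eq0 ((pcharf0P K).1 charK0).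
by move/eqP.
Qed.

Section ThreeLieDual.
Variables (K : fieldType) (A V : lmodType K).
Variable br : {linear A -> {linear A -> {linear A -> A}}}.
Variable rho : {linear A -> {linear A -> {linear V -> V}}}.
Hypothesis charK0 : [pchar K] =i pred0.
Hypothesis brP : is_3Lie br.
Hypothesis rhoP : is_3Lie_rep br rho.

Lemma br_cycle x y z : br x y z = br y z x.
Proof. by case: brP => s12 s23 _; rewrite s12 s23 opprK. Qed.

Lemma rhoC x y u : rho x y u = - rho y x u.
Proof. by case: rhoP. Qed.

(** Pairing with [xi] turns the operator identities into scalar ones in [K], where [ring]
    applies. *)
Lemma rho_br_opposite x1 x2 x3 x4 (xi : {linear V -> K^o}) u :
  xi (rho (br x1 x2 x3) x4 u) =
    - (xi (rho x3 x4 (rho x1 x2 u)) + xi (rho x1 x4 (rho x2 x3 u))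
       + xi (rho x2 x4 (rho x3 x1 u))).
Proof.
case: rhoP => _ r1 r2.
have xiB a b : xi (a - b) = xi a - xi b by exact: linearB.
have xiD a b : xi (a + b) = xi a + xi b by exact: linearD.
have xiN a : xi (- a) = - xi a by exact: linearN.
have rhoN y z a : rho y z (- a) = - rho y z a by exact: linearN.
have c1 := congr1 xi (r1 x1 x2 x3 x4 u).
have c2 := congr1 xi (r1 x2 x3 x1 x4 u).
have c3 := congr1 xi (r1 x3 x1 x2 x4 u).
have z1 := congr1 xi (r2 x1 x2 x4 x3 u).
have z2 := congr1 xi (r2 x2 x3 x4 x1 u).
have z3 := congr1 xi (r2 x3 x1 x4 x2 u).
(* By cyclic invariance [c1], [c2], [c3] share one unknown; skew-symmetry of [rho] then brings [z1],
   [z2], [z3] to the same six products. *)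
rewrite -(br_cycle x1 x2 x3) in c2; rewrite (br_cycle x3 x1 x2) in c3.
rewrite (rhoC x4 x3) (rhoC x1 x3) (rhoC x4 x1) !rhoN in z1.
rewrite (rhoC x4 x1) (rhoC x2 x1) (rhoC x4 x2) !rhoN in z2.
rewrite (rhoC x4 x2) (rhoC x3 x2) (rhoC x4 x3) !rhoN in z3.
rewrite !(xiB, xiD, xiN) in c1 c2 c3 z1 z2 z3 *.
move: c1 c2 c3 z1 z2 z3.
move: (xi (rho (br x1 x2 x3) x4 u)) (xi (rho (br x1 x2 x4) x3 u))
  (xi (rho (br x2 x3 x4) x1 u)) (xi (rho (br x3 x1 x4) x2 u)).
move: (xi (rho x1 x2 _)) (xi (rho x3 x4 _)) (xi (rho x2 x3 _))
  (xi (rho x1 x4 _)) (xi (rho x3 x1 _)) (xi (rho x2 x4 _)).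
move=> ab ba cd dc ef fe Y X1 X2 X3 c1 c2 c3 z1 z2 z3.
have K3 : (3%:R : K) != 0 by rewrite ((pcharf0P K).1 charK0).
apply: (mulfI K3).
have -> : 3%:R * Y = (ab - ba + X1) + (cd - dc + X2) + (ef - fe + X3).
  by rewrite c1 c2 c3; ring.
rewrite z1 z2 z3; ring.
Qed.

Lemma rho_dual_3Lie_rep : is_3Lie_rep br (rho_dual rho).
Proof.
case: rhoP => _ r1 _; split.
- move=> x y xi; apply: eq_linear => v.
  by rewrite [RHS]linear_oppE !rho_dualE rhoC linearN.
- move=> x1 x2 x3 x4 xi; apply: eq_linear => v.
  rewrite !linear_subE !rho_dualE !opprK.
  have := congr1 xi (r1 x1 x2 x3 x4 v).
  rewrite !linearB /= => /(congr1 -%R).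
  by rewrite !opprB => ->; rewrite addrC.
- move=> x1 x2 x3 x4 xi; apply: eq_linear => v.
  rewrite !(linear_addE, rho_dualE) !opprK.
  by rewrite rho_br_opposite opprK.
Qed.

End ThreeLieDual.

Section DualTensors.
Variables (K : fieldType) (A V : lmodType K).
Variable mul : {linear A -> {linear A -> A}}.
Variable br : {linear A -> {linear A -> {linear A -> A}}}.
Variable rho : {linear A -> {linear A -> {linear V -> V}}}.
Variable mu : {linear A -> {linear V -> V}}.
Implicit Type xi : {linear V -> K^o}.

Lemma opp_mu_dualE x xi v : (- mu_dual mu) x xi v = xi (mu x v).
Proof. exact: opprK. Qed.

Lemma calL1_dual x y z xi v :
  calL1 br (rho_dual rho) (- mu_dual mu) x y z xi v =
    xi (calL1 br rho mu x y z v).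
Proof.
rewrite /calL1 2!(linearB xi) 2!linear_subE rho_dualE 3!opp_mu_dualE rho_dualE.
by rewrite opprK [- _ + _]addrC.
Qed.

(** Transposition reverses composition, turning the [mu]-[rho] products of [calL2] into the
    [rho]-[mu] products of [calL3]; the sign comes from [rho_dual]. *)
Lemma calL2_dual x y z xi v :
  calL2 mul (rho_dual rho) (- mu_dual mu) x y z xi v =
    - xi (calL3 mul rho mu x y z v).
Proof.
rewrite /calL2 /calL3 linear_subE linear_addE !opp_mu_dualE !rho_dualE.
by rewrite (linearB xi) (linearD xi) opprB opprD opprK addrC.
Qed.

Hypothesis brP : is_3Lie br.

Lemma calL_skew x y z t : calL mul br y x z t = - calL mul br x y z t.
Proof.
case: brP => s12 _ _.
rewrite /calL !(s12 y x) !(linearN (mul _)) (linearN mul) linear_oppE.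
by rewrite !opprD !opprK.
Qed.

(** The two bracket terms cancel by skew-symmetry of [br], and the [mu]-[rho] products of [calL1]
    cancel those of [calL2]. *)
Lemma calL3E x y z u :
  calL3 mul rho mu x y z u =
    calL2 mul rho mu x y z u
    + (calL1 br rho mu x y z u + calL1 br rho mu x z y u).
Proof.
case: brP => _ s23 _.
rewrite /calL3 /calL2 /calL1 (s23 x z y) (linearN mu) linear_oppE opprK.
rewrite [X in _ = _ + X]addrACA addNr addr0 [X in _ = _ + X]addrACA -opprD.
by rewrite [RHS]addrC addrA subrK.
Qed.

End DualTensors.

Theorem proposition4p7 (K : closedFieldType) (charK0 : [pchar K] =i pred0)
  (A : lmodType K)
  (mul : {linear A -> {linear A -> A}})
  (br : {linear A -> {linear A -> {linear A -> A}}})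
  (hA : is_ternary_F_manifold mul br)
  (V : lmodType K)
  (rho : {linear A -> {linear A -> {linear V -> V}}})
  (mu : {linear A -> {linear V -> V}})
  (hV : is_ternary_F_manifold_rep mul br rho mu)
  (h1 : forall x y z t u,
     calL1 br rho mu (mul x y) z t u =
       calL1 br rho mu y z t (mu x u) + calL1 br rho mu x z t (mu y u))
  (h2 : forall x y z t u,
     calL3 mul rho mu (mul x y) z t u =
       - calL3 mul rho mu y z t (mu x u) - calL3 mul rho mu x z t (mu y u))
  (h3 : forall x y z t u,
     mu (calL mul br x y z t) u =
       calL3 mul rho mu y z t (mu x u) - mu x (calL3 mul rho mu y z t u)) :
  is_ternary_F_manifold_rep mul br (rho_dual rho) (- mu_dual mu).
Proof.
case: hA => -[mulC _] brP _; case: hV => rhoP muM m1 m2 _.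
have L3M x y z t u : calL3 mul rho mu (mul x y) z t u =
    mu x (calL3 mul rho mu y z t u) + mu y (calL3 mul rho mu x z t u).
  rewrite !(calL3E _ _ _ brP) m2 !m1.
  move: (calL2 _ _ _ y z t u) (calL1 _ _ _ y z t u) (calL1 _ _ _ y t z u).
  move: (calL2 _ _ _ x z t u) (calL1 _ _ _ x z t u) (calL1 _ _ _ x t z u) => *.
  rewrite !linearD.
  by rewrite [X in _ + X = _]addrACA [LHS]addrACA.
have L3_mul0 x y z t u : calL3 mul rho mu (mul x y) z t u = 0.
  apply: (eq_opp_eq0 charK0); rewrite {1}h2 L3M -opprD; congr (- _).
  (* [h3] moves [mu] from inside [calL3] to outside; the two correction terms are opposite by
     [calL_skew]. *)
  have /eqP := h3 x y z t u; rewrite eq_sym subr_eq => /eqP ->.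
  have /eqP := h3 y x z t u; rewrite eq_sym subr_eq => /eqP ->.
  rewrite (calL_skew mul brP x y) (linearN mu) linear_oppE.
  by rewrite addrACA subrr add0r.
have L3_cocycle x y z t u :
    calL3 mul rho mu y z t (mu x u) + calL3 mul rho mu x z t (mu y u) = 0.
  by apply: oppr_inj; rewrite oppr0 opprD -h2.
split.
- exact: rho_dual_3Lie_rep.
- move=> x y xi; apply: eq_linear => v; rewrite !opp_mu_dualE.
  (* Commutativity undoes the order reversal caused by transposition. *)
  by rewrite mulC muM.
- move=> x1 x2 x3 x4 xi; apply: eq_linear => v.
  by rewrite [RHS]linear_addE 2!opp_mu_dualE 3!calL1_dual h1 linearD.
- move=> x1 x2 x3 x4 xi; apply: eq_linear => v.
  rewrite [RHS]linear_addE 2!opp_mu_dualE 3!calL2_dual.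
  (* Both sides vanish, so the sign in [h2] does no harm. *)
  by rewrite -opprD -linearD L3_cocycle L3_mul0.
- move=> x1 x2 x3 x4 xi; apply: eq_linear => v.
  rewrite [RHS]linear_subE 2!opp_mu_dualE 2!calL2_dual opp_mu_dualE h3.
  by rewrite linearB opprK addrC.
Qed.
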